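(* Let $\tau(n)$, $n\ge1$, be the integers defined by $$\Delta(q)=q\prod_{m\ge1}(1-q^m)^{24}=\sum_{n\ge1}\tau(n)q^n.$$ Then for every integer $n\ge1$: $\tau(2n)\equiv0\pmod2$, $\tau(3n-1)\equiv0\pmod3$, and $\tau(3n)\equiv0\pmod3$.
   Context: $\tau$ is Ramanujan's tau function; the product is understood as a formal power series in $q$. *)

(* Defs.v *)
From mathcomp Require Import all_boot all_order all_algebra.

Set Implicit Arguments.
Unset Strict Implicit.
Unset Printing Implicit Defensive.

Import Order.TTheory GRing.Theory Num.Theory.
Local Open Scope ring_scope.

(* A formal power series over R is given by its
   coefficient sequence [nat -> R]; convergence in R[[q]] (the q-adic topology)
   means that every coefficient is eventually constant. *)
Definition fps_cvg (R : nzRingType) (u : nat -> {poly R}) (f : nat -> R) : Prop :=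
  forall n : nat, exists N0 : nat, forall N : nat, (N0 <= N)%N -> (u N)`_n = f n.

Definition Delta_partial (N : nat) : {poly int} :=
  'X * \prod_(1 <= m < N.+1) (1 - 'X^m) ^+ 24.

(* The series on the right-hand side starts at n = 1, so the value [tau 0] is
   not constrained. *)
Definition is_ramanujan_tau (tau : nat -> int) : Prop :=
  fps_cvg Delta_partial (fun n => if n == 0%N then 0 else tau n).

Lemma Delta_partial_stable (n N : nat) :
  (n <= N)%N -> (Delta_partial N)`_n = (Delta_partial n)`_n.
Proof.
elim: N => [|N IHN]; first by rewrite leqn0 => /eqP->.
rewrite leq_eqVlt => /orP[/eqP-> //|]; rewrite ltnS => le_nN.
rewrite -(IHN le_nN) /Delta_partial big_nat_recr //= mulrA.
have [q ->] : exists q : {poly int}, (1 - 'X^(N.+1)) ^+ 24 = 1 + 'X^(N.+1) * q.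
  elim: 24%N => [|k [q IHk]]; first by exists 0; rewrite mulr0 addr0 expr0.
  exists (q - 1 - 'X^(N.+1) * q).
  rewrite exprS IHk mulrBl mul1r mulrDr mulr1 !mulrBr mulr1 -!addrA.
  by congr (_ + (_ + _)); rewrite opprD.
by rewrite mulrDr mulr1 coefD mulrCA coefXnM ltnS le_nN addr0.
Qed.

Lemma ramanujan_tau_exists : exists tau : nat -> int, is_ramanujan_tau tau.
Proof.
exists (fun n => (Delta_partial n)`_n) => n; exists n => N le_nN.
rewrite (Delta_partial_stable le_nN); case: eqP => // ->.
by rewrite /Delta_partial coefXM.
Qed.

Lemma ramanujan_tau_unique (tau tau' : nat -> int) :
  is_ramanujan_tau tau -> is_ramanujan_tau tau' ->
  forall n : nat, (1 <= n)%N -> tau n = tau' n.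
Proof.
move=> tauP tau'P n n_gt0; have [N1 H1] := tauP n; have [N2 H2] := tau'P n.
have := H1 _ (leq_maxl N1 N2); rewrite (H2 _ (leq_maxr N1 N2)).
by rewrite -[n == 0%N]negbK -lt0n n_gt0.
Qed.

(* Main.v *)
Require Import Defs.
From mathcomp Require Import all_boot all_order all_algebra.

Set Implicit Arguments.
Unset Strict Implicit.
Unset Printing Implicit Defensive.

Import Order.TTheory GRing.Theory Num.Theory.
Local Open Scope ring_scope.

(** For a prime p dividing 24, the product of the (1 - q^m)^24 is a p-th power,
    so modulo p it is a series in q^p by Frobenius. Multiplying by q, only the
    exponents congruent to 1 modulo p survive in Delta; take p = 2 and p = 3. *)

Lemma coef_exp_pchar (R : comNzRingType) (p : nat) (P : {poly R}) (k : nat) :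
  p \in [pchar R] -> ~~ (p %| k)%N -> (P ^+ p)`_k = 0.
Proof.
move=> pcharRp p_ndvd_k.
have pcharPp : p \in [pchar {poly R}] by rewrite pchar_poly.
rewrite -(pFrobenius_autE pcharPp) -[P]coefK poly_def rmorph_sum coef_sum.
apply: big1 => i _; rewrite /= pFrobenius_autE exprZn -exprM coefZ coefXn.
case: eqP => [k_eq|_]; last by rewrite mulr0.
by move: p_ndvd_k; rewrite k_eq dvdn_mull.
Qed.

Lemma tau_dvd_prime (tau : nat -> int) (p k : nat) :
  is_ramanujan_tau tau -> prime p -> (p %| 24)%N -> ~~ (p %| k)%N ->
  (tau k.+1 = 0 %[mod p])%Z.
Proof.
move=> tauP p_pr p_dvd24 p_ndvd_k.
(* A single partial product already attains this coefficient. *)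
have [N0 /(_ N0 (leqnn N0)) /= <-] := tauP k.+1.
rewrite mod0z; apply/dvdz_mod0P.
rewrite (dvdz_pcharf (pchar_Fp p_pr)); apply/eqP.
(* The factor ['X] shifts the index to [k]; the rest is a [p]-th power since 24 = (24 / p) * p. *)
rewrite /Delta_partial coefXM /= prodrXl -(divnK p_dvd24) exprM.
by rewrite -coef_map rmorphXn /= coef_exp_pchar ?pchar_Fp.
Qed.

Theorem corollary2p5 (tau : nat -> int) (tauP : is_ramanujan_tau tau)
    (n : nat) (n_ge1 : (1 <= n)%N) :
  [/\ (tau (2 * n)%N = 0 %[mod 2])%Z,
      (tau (3 * n - 1)%N = 0 %[mod 3])%Z
    & (tau (3 * n)%N = 0 %[mod 3])%Z].
Proof.
(* With [n.+1] for [n], the indices are [k.+1] for k = 2n+1, 3n+1, 3n+2. *)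
case: n n_ge1 => // n _; rewrite !mulnS subn1 !addSn !add0n; split.
- by apply: (@tau_dvd_prime _ 2) => //; rewrite -(addn1 (2 * n)) dvdn_addr ?dvdn_mulr.
- by apply: (@tau_dvd_prime _ 3) => //; rewrite -(addn1 (3 * n)) dvdn_addr ?dvdn_mulr.
- by apply: (@tau_dvd_prime _ 3) => //; rewrite -(addn2 (3 * n)) dvdn_addr ?dvdn_mulr.
Qed.
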